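(* The function $\mathfrak{X}:\Sigma^{\mathbb N}\to\Theta$ given by $$\mathfrak{X}\big(\langle(\varepsilon_n,\bar a_n)\rangle_{n\ge1}\big)=[\varepsilon_1b_1,\varepsilon_2b_2,\varepsilon_3b_3,\ldots]_-,\qquad b_n=\bar a_n+\frac{1+\varepsilon_n\varepsilon_{n+1}}{2},$$ is a homeomorphism conjugating the shift map $\mathfrak{s}:\Sigma^{\mathbb N}\to\Sigma^{\mathbb N}$ with the map $G:\Theta\to\Theta$, i.e. $\mathfrak{X}\circ\mathfrak{s}=G\circ\mathfrak{X}$.
   Context: $\Theta:=(-\frac12,\frac12)\setminus\mathbb{Q}$ with the subspace topology. $\mathbb N=\{1,2,3,\dots\}$. $\Sigma:=\{-1,+1\}\times\mathbb{N}_{\ge2}$ (discrete), and $\Sigma^{\mathbb N}=\{\langle(\varepsilon_n,\bar a_n)\rangle_{n\ge1}:\varepsilon_n\in\{-1,+1\},\ \bar a_n\in\mathbb{N}_{\ge2}\}$ has the product topology. The shift is $\mathfrak{s}(\langle(\varepsilon_n,\bar a_n)\rangle_{n\ge1})=\langle(\varepsilon_{n+1},\bar a_{n+1})\rangle_{n\ge1}$. The map $G:\Theta\to\Theta$ sends $\theta$ to the unique element $G(\theta)\in\Theta$ with $G(\theta)\equiv-\frac1\theta\pmod 1$. For non-zero integers $x_1,x_2,\ldots$, $[x_1,\ldots,x_n]_-:=1/(x_1-1/(x_2-\cdots-1/(x_{n-1}-1/x_n)\cdots))$, and $[x_1,x_2,x_3,\ldots]_-:=\lim_{n\to\infty}[x_1,\ldots,x_n]_-$.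 *)

(* Defs.v *)
From HB Require Import structures.
From mathcomp Require Export all_boot all_order all_algebra.
From mathcomp Require Export all_classical all_reals all_analysis.
From mathcomp Require Import lra.

Set Implicit Arguments.
Unset Strict Implicit.
Unset Printing Implicit Defensive.

Import Order.TTheory GRing.Theory Num.Theory.
Import numFieldNormedType.Exports.

Local Open Scope classical_set_scope.
Local Open Scope ring_scope.

Definition homeomorphism (S T : topologicalType) (f : S -> T) : Prop :=
  continuous f /\
  exists g : T -> S, [/\ cancel f g, cancel g f & continuous g].

(* Used as a type, this set is its [set_type], whose topology is the initial
   one for the inclusion into [R], that is, the subspace topology. *)
Definition Theta (R : realType) : set R :=
  `]- (1 / 2), 1 / 2[ `&` irrational.

Arguments Theta : clear implicits.

Definition in_alphabet (p : int * nat) : bool :=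
  ((p.1 == -1) || (p.1 == 1)) && (2 <= p.2)%N.

Definition Sigma : Type := discrete_topology {p : int * nat | in_alphabet p}.

Definition eps (c : Sigma) : int := (val c).1.
Definition abar (c : Sigma) : nat := (val c).2.

(* Sequences are indexed from 0: the term of index [n] is the pair written
   with subscript n + 1 on paper. *)
Definition SigmaN : Type := {ptws nat -> Sigma}.

Definition shift (s : SigmaN) : SigmaN := fun n => s n.+1.

(* The integer quotient is exact, since the dividend is 0 or 2. *)
Definition b (s : SigmaN) (n : nat) : int :=
  (abar (s n))%:Z + ((1 + eps (s n) * eps (s n.+1)) %/ 2)%Z.

(* [ncf R [:: x1; ...; xn]] is 1 / (x1 - 1 / (x2 - ... - 1 / xn)), the empty
   fraction being 0.  Since [0^-1 = 0] in [R], the value is meaningful only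
   if all denominators are nonzero, as asserted by [ncf_defined]. *)
Fixpoint ncf (R : realType) (xs : seq int) : R :=
  if xs is x :: xs' then 1 / (x%:~R - ncf R xs') else 0.

Fixpoint ncf_defined (R : realType) (xs : seq int) : bool :=
  if xs is x :: xs' then
    ncf_defined R xs' && (x%:~R - ncf R xs' != 0)
  else true.

(* [x 0, x 1, ...]_- = l *)
Definition is_ncf (R : realType) (x : nat -> int) (l : R) : Prop :=
  (forall n, ncf_defined R (mkseq x n)) /\
  ncf R (mkseq x n) @[n --> \oo] --> l.

Definition eqmod1 (R : realType) (x y : R) : Prop := x - y \is a Num.int.

Lemma G_exists (R : realType) (t : Theta R) :
  exists u : Theta R, eqmod1 (val u) (- (1 / val t)).
Proof.
set y : R := - (1 / val t).
have irrt : irrational (val t) by case: (set_mem (valP t)).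
have ratl_irr (q : rat) : ratr q != y.
  apply/eqP => qy; apply: irrt; exists (- q^-1) => //.
  by rewrite rmorphN/= fmorphV/= qy /y div1r invrN invrK opprK.
have qN (k : int) (q : rat) : ratr q != y - k%:~R.
  apply/eqP => qy; have /eqP[] := ratl_irr (q + k%:~R).
  by rewrite rmorphD/= ratr_int qy subrK.
pose k := Num.floor (y + 1 / 2).
have /andP[k1 k2] := floor_itv (y + 1 / 2).
have hneq : y - k%:~R != - (1 / 2).
  have := qN k (- (1 / 2)); rewrite rmorphN/= fmorph_div/= rmorph1 ratr_nat.
  by rewrite eq_sym.
have yT : Theta R (y - k%:~R).
  split; last by move=> [q _ qy]; have := qN k q; rewrite qy eqxx.
  rewrite /= in_itv/= lt_neqAle eq_sym hneq /=.
  rewrite -/k intrD in k1 k2.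
  by apply/andP; split; lra.
exists (SigSub (mem_set yT)).
by rewrite /eqmod1/= addrAC subrr add0r rpredN intr_int.
Qed.

Lemma G_unique (R : realType) (t u v : Theta R) :
  eqmod1 (val u) (- (1 / val t)) -> eqmod1 (val v) (- (1 / val t)) -> u = v.
Proof.
move=> uP vP; apply: val_inj.
have := rpredB uP vP; rewrite opprB addrA subrK => /intrP[k uv].
case: (set_mem (valP u)) (set_mem (valP v)) => + _ [+ _].
rewrite /= !in_itv/= => /andP[u1 u2] /andP[v1 v2].
have {}uv : sval u - sval v = k%:~R := uv.
have k1 : (k%:~R : R) < 1 by rewrite -uv; lra.
have k2 : (-1 : R) < k%:~R by rewrite -uv; lra.
have k0 : k = 0.
  move: k1 k2; rewrite -[1]/(1%:~R) -mulrNz !ltr_int; clear.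
  by case: k => [[|n]|[|n]].
by apply/eqP; rewrite -subr_eq0 uv k0.
Qed.

Definition G (R : realType) (t : Theta R) : Theta R := sval (cid (G_exists t)).

Lemma G_eqmod1 (R : realType) (t : Theta R) :
  eqmod1 (val (G t)) (- (1 / val t)).
Proof. exact: svalP (cid (G_exists t)). Qed.

(* Main.v *)
Require Import Defs.
From mathcomp Require Import ring lra.

Import Order.TTheory GRing.Theory Num.Theory.
Import numFieldNormedType.Exports.
Local Open Scope classical_set_scope.
Local Open Scope ring_scope.

(** Fix a sequence of letters, with signs e_n and partial denominators
    x_n = e_n b_n, and follow the tails T_n = [x_n, x_(n+1), ...]_- of the
    fraction, so that T_n = 1 / (x_n - T_(n+1)).  The correction term
    (1 + e_n e_(n+1)) / 2 in b_n is what makes the half intervals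
    [0, e_n / 2] invariant: if v lies in [0, e_(n+1) / 2], then
    e_n (x_n - v) is at least 2, because b_n is at least 3 when v has the sign
    e_n, and v only enlarges the denominator otherwise ([den_sub_ge2]).  Hence
    v |-> 1 / (x_n - v) maps the half interval of e_(n+1) into that of e_n
    ([half_interval_step]) and contracts distances by a factor 4
    ([contraction_step]).  All denominators are therefore nonzero, and the
    convergents converge geometrically, uniformly in the sequence.  As the
    n-th convergent reads only the first n + 1 letters, the limit is a uniform
    limit of locally constant functions, hence continuous.

    The limit is irrational by descent: a tail T = p / q satisfies |T| <= 1/2
    and T != 0, and the next tail x - q / p has the strictly smaller
    denominator p ([ncf_lim_descent]).  It thus lies in Theta, and T = 1/(x - T')
    says that T' is congruent to - 1 / T, that is, T' = G T: this is the
    conjugacy.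

    The inverse is the itinerary under G.  From 1 / |T| = b - e T' one sees
    that 1 / |T| lies strictly between abar and abar + 1, whichever the sign of
    T' is, so that the first letter is (sign T, floor (1 / |T|)), a function of
    T alone ([digit]).  Conversely any t in Theta is 1 / (x - G t), where x is
    read off its own itinerary ([den_itinerary]), so the contraction estimate
    shows that the fraction of the itinerary of t converges to t.  As 1 / |t| is
    never an integer and G t is never on the boundary of (-1/2, 1/2), both
    [digit] and G are continuous on Theta, and so is the itinerary. *)

Section NearestIntegerCoding.
Local Set Implicit Arguments.
Local Unset Strict Implicit.
Local Unset Printing Implicit Defensive.
Context {R : realType}.
Implicit Types (s : SigmaN) (c : Sigma) (v w : R) (t u : Theta R).

(** * Half intervals and the contraction estimate *)

Definition epsR c : R := (eps c)%:~R.

Lemma eps_pm1 c : eps c = -1 \/ eps c = 1.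
Proof. by have /andP[/orP[]/eqP ? _] := valP c; [left|right]. Qed.

Lemma epsR_pm1 c : epsR c = -1 \/ epsR c = 1.
Proof.
by case: (eps_pm1 c) => h; [left|right]; rewrite /epsR h ?mulrN1z ?mulr1z.
Qed.

Lemma epsR_neq0 c : epsR c != 0.
Proof. by case: (epsR_pm1 c) => ->; rewrite ?oppr_eq0 oner_eq0. Qed.

Lemma abar_ge2 c : 2 <= (abar c)%:R :> R.
Proof. by have /andP[_ ?] := valP c; rewrite (ler_nat R 2). Qed.

Definition den s (n : nat) : int := eps (s n) * b s n.

Lemma den0E s : (den s 0)%:~R =
  epsR (s 0) * ((abar (s 0))%:R + (1 + epsR (s 0) * epsR (s 1)) / 2) :> R.
Proof.
rewrite /den /b /epsR intrM intrD.
(* The four possible integer quotients are decided by computation. *)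
have m1 : ((1 + -1 * -1) %/ 2)%Z = 1 by [].
have m2 : ((1 + -1 * 1) %/ 2)%Z = 0 by [].
have m3 : ((1 + 1 * -1) %/ 2)%Z = 0 by [].
have m4 : ((1 + 1 * 1) %/ 2)%Z = 1 by [].
by case: (eps_pm1 (s 0)) => ->; case: (eps_pm1 (s 1)) => ->;
   rewrite ?(m1, m2, m3, m4) -[_%:Z%:~R]/((abar (s 0))%:R : R); lra.
Qed.

(** The closed segment from 0 to half the sign of [c]: where the tails whose first
    letter is [c] lie.  It contains 0, the tail of a finite fraction. *)
Definition half_interval c : set R :=
  [set v | `|v| <= 1 / 2 /\ 0 <= epsR c * v].

Lemma half_interval0 c : half_interval c 0.
Proof. by split; rewrite ?normr0 ?mulr0//; lra. Qed.

(** When the signs of the first two letters agree, the partial denominator is at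
    least 3 in absolute value and [v] takes away at most 1 / 2; when they
    differ, it is at least 2 and [v] adds to it. *)
Lemma den_sub_ge2 s v : half_interval (s 1) v ->
  2 <= epsR (s 0) * ((den s 0)%:~R - v).
Proof.
rewrite /half_interval /= den0E ler_norml => -[/andP[v1 v2] ev].
have := abar_ge2 (s 0); move: ev.
by case: (epsR_pm1 (s 0)) => ->; case: (epsR_pm1 (s 1)) => ->; lra.
Qed.

Lemma den_sub_norm_ge2 s v : half_interval (s 1) v ->
  2 <= `|(den s 0)%:~R - v|.
Proof.
move=> /den_sub_ge2; rewrite ler_normr => h; apply/orP; move: h.
by case: (epsR_pm1 (s 0)) => ->; [right|left]; lra.
Qed.

Lemma den_sub_neq0 s v : half_interval (s 1) v -> (den s 0)%:~R - v != 0.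
Proof. by move=> /den_sub_norm_ge2 h; rewrite -normr_gt0; lra. Qed.

Lemma half_interval_step s v : half_interval (s 1) v ->
  half_interval (s 0) (1 / ((den s 0)%:~R - v)).
Proof.
move=> h; have := den_sub_ge2 h; have := den_sub_norm_ge2 h.
set y := _ - v => y2 ey2; split.
  rewrite normrM normr1 normfV !div1r lef_pV2// posrE; lra.
have : 0 <= (epsR (s 0) * y)^-1 by rewrite invr_ge0; lra.
by case: (epsR_pm1 (s 0)) => ->; rewrite ?mul1r ?mulN1r ?invrN.
Qed.

(** The two values differ by (v - w) divided by the product of the two
    denominators, each of which is at least 2. *)
Lemma contraction_step s v w : half_interval (s 1) v -> half_interval (s 1) w ->
  `|1 / ((den s 0)%:~R - v) - 1 / ((den s 0)%:~R - w)| <= `|v - w| / 4.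
Proof.
move=> hv hw.
have := den_sub_norm_ge2 hv; have := den_sub_norm_ge2 hw.
have := den_sub_neq0 hv; have := den_sub_neq0 hw.
set y := _ - v; set z := _ - w => z0 y0 z2 y2.
have -> : 1 / y - 1 / z = (v - w) / (y * z) by rewrite /y /z; field; apply/andP.
rewrite normrM normfV ler_wpM2l// lef_pV2 ?posrE ?normr_gt0 ?mulf_neq0//.
by rewrite normrM; nra.
Qed.

(** * Convergence of the fractions *)

Definition convergent n s : R := ncf R (mkseq (den s) n).

Lemma mkseqS_shift T (f : nat -> T) n :
  mkseq f n.+1 = f 0%N :: mkseq (fun k => f k.+1) n.
Proof. by rewrite /mkseq /= -add1n iotaDl -map_comp. Qed.

Lemma convergentS n s :
  convergent n.+1 s = 1 / ((den s 0)%:~R - convergent n (shift s)).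
Proof. by rewrite /convergent mkseqS_shift. Qed.

Lemma convergent_half n s : half_interval (s 0) (convergent n s).
Proof.
elim: n s => [|n IHn] s; first exact: half_interval0.
by rewrite convergentS; apply: half_interval_step; exact: (IHn (shift s)).
Qed.

Lemma den_ncf_defined n s : ncf_defined R (mkseq (den s) n).
Proof.
elim: n s => [//|n IHn] s; rewrite mkseqS_shift /= (IHn (shift s)) /=.
exact/den_sub_neq0/(convergent_half n (shift s)).
Qed.

(** The sequences of tails met below (those of longer convergents, of the limit,
    and the orbits of [G]) approach the convergents at a geometric rate by
    induction, from these two lemmas. *)
Lemma convergent_close0 s v :
  half_interval (s 0) v -> `|v - convergent 0 s| <= (1 / 4) ^+ 0.
Proof. by case=> + _; rewrite /convergent /= subr0 expr0; lra. Qed.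

Lemma convergent_closeS n s v : half_interval (s 1) v ->
  `|v - convergent n (shift s)| <= (1 / 4) ^+ n ->
  `|1 / ((den s 0)%:~R - v) - convergent n.+1 s| <= (1 / 4) ^+ n.+1.
Proof.
move=> hv vn; rewrite convergentS exprS.
have := contraction_step hv (convergent_half n (shift s)).
by lra.
Qed.

Lemma convergent_cauchy n m s :
  `|convergent (n + m) s - convergent n s| <= (1 / 4) ^+ n.
Proof.
elim: n s => [|n IHn] s; first exact/convergent_close0/convergent_half.
rewrite addSn [convergent (n + m).+1 s]convergentS.
exact: convergent_closeS (convergent_half _ (shift s)) (IHn (shift s)).
Qed.

Definition ncf_lim s : R := limn (convergent ^~ s).

Lemma expr_quarter_lt (e : R) : 0 < e -> exists n, (1 / 4) ^+ n < e.
Proof.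
move=> e0; have : (1 / 4) ^+ n @[n --> \oo] --> (0 : R).
  have q1 : `|1 / 4 : R| < 1 by rewrite ger0_norm; lra.
  exact: cvg_expr.
move=> /cvgrPdist_lt/(_ e e0)[N _ /(_ N (leqnn N))]/=.
by rewrite sub0r normrN ger0_norm ?exprn_ge0//; [exists N | lra..].
Qed.

Lemma convergent_cvg s : convergent n s @[n --> \oo] --> ncf_lim s.
Proof.
suff : cvgn (convergent ^~ s) by [].
apply/cauchy_cvgP/cauchy_exP => e e0.
have [N Ne] := expr_quarter_lt e0.
exists (convergent N s); exists N => //= n /subnKC <-.
by rewrite -ball_normE /ball_ /= distrC (le_lt_trans (convergent_cauchy _ _ _)).
Qed.

(** The half intervals are closed. *)
Lemma ncf_lim_half s : half_interval (s 0) (ncf_lim s).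
Proof.
have cs := @convergent_cvg s; have ch n := convergent_half n s.
split.
  rewrite -(cvg_lim (@Rhausdorff R) (cvg_norm cs)).
  by apply: limr_le; [exact: cvgP (cvg_norm cs)|near=> n; case: (ch n)].
have ces := cvgM (cvg_cst (epsR (s 0))) cs.
rewrite -(cvg_lim (@Rhausdorff R) (ces _ _)).
by apply: limr_ge; [exact: cvgP (ces _ _)|near=> n; case: (ch n)].
Unshelve. all: by end_near. Qed.

Lemma ncf_limE s : ncf_lim s = 1 / ((den s 0)%:~R - ncf_lim (shift s)).
Proof.
have : convergent n.+1 s @[n --> \oo] --> ncf_lim s.
  by rewrite (cvg_shiftS (convergent ^~ s)); exact: convergent_cvg.
under eq_cvg do rewrite convergentS.
move=> /(cvg_lim (@Rhausdorff R)) <-; apply: cvg_lim => //.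
under eq_cvg do rewrite div1r; rewrite div1r; apply: cvgV.
  exact/den_sub_neq0/(ncf_lim_half (shift s)).
by apply: cvgB; [exact: cvg_cst|exact: convergent_cvg].
Qed.

Lemma ncf_lim_close n s : `|ncf_lim s - convergent n s| <= (1 / 4) ^+ n.
Proof.
elim: n s => [|n IHn] s; first exact/convergent_close0/ncf_lim_half.
rewrite ncf_limE.
exact: convergent_closeS (ncf_lim_half (shift s)) (IHn (shift s)).
Qed.

(** * The limit is an irrational number conjugating the shift with G *)

Lemma ncf_lim_neq0 s : ncf_lim s != 0.
Proof.
by rewrite ncf_limE div1r invr_eq0 (den_sub_neq0 (ncf_lim_half (shift s))).
Qed.

(** If the limit is [p / q] with [q] nonzero, then [|p| < |q|] since the limit is
    at most 1 / 2 in absolute value, and the next tail is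
    [den s 0 - q / p], a fraction of denominator [p]: infinite descent. *)
Lemma ncf_lim_descent n s (p q : int) :
  (`|q| <= n)%N -> ncf_lim s * q%:~R = p%:~R -> q = 0.
Proof.
elim: n s p q => [|n IHn] s p q qn pE.
  by apply/eqP; rewrite -absz_eq0 -leqn0.
apply: contra_eq (pE) => q0.
have [xs2 _] := ncf_lim_half s.
have pq : (`|p| < `|q|)%N.
  rewrite -ltz_nat !abszE -(ltr_int R) !intr_norm -pE normrM.
  have : 0 < `|q%:~R : R| by rewrite normr_gt0 intr_eq0.
  by nra.
have p0 : p != 0 by rewrite -(intr_eq0 R) -pE mulf_neq0 ?ncf_lim_neq0 ?intr_eq0.
suff /eqP : p = 0 by rewrite (negPf p0).
apply: (IHn (shift s) (den s 0 * p - q)).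
  by rewrite -ltnS (leq_trans pq).
have := den_sub_neq0 (ncf_lim_half (shift s)).
by rewrite intrD intrM mulrNz -pE (ncf_limE s) => h; field.
Qed.

Lemma ncf_lim_irrational s : irrational (ncf_lim s).
Proof.
move=> [r _ rE].
have /eqP : denq r = 0; last by rewrite denq_eq0.
apply: (@ncf_lim_descent `|denq r| s (numq r)) => //.
by rewrite -rE /ratr mulfVK// intr_eq0 denq_eq0.
Qed.

Lemma ncf_lim_in_Theta s : Theta R (ncf_lim s).
Proof.
split; last exact: ncf_lim_irrational.
have [] := ncf_lim_half s; rewrite ler_norml => /andP[h1 h2] _.
have nr (q : rat) : ncf_lim s != ratr q.
  by apply/eqP => h; apply: (@ncf_lim_irrational s); exists q.
have := nr (1 / 2); have := nr (- (1 / 2)).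
rewrite rmorphN /= (_ : ratr (1 / 2) = 1 / 2) => [n1 n2|]; last first.
  by rewrite fmorph_div /= rmorph1 ratr_nat.
by rewrite /= in_itv /= !lt_neqAle h1 h2 n2 eq_sym n1.
Qed.

Definition ncf_Theta s : Theta R := SigSub (mem_set (ncf_lim_in_Theta s)).

Lemma val_ncf_Theta s : val (ncf_Theta s) = ncf_lim s.
Proof. by []. Qed.

Lemma ncf_Theta_shift s : ncf_Theta (shift s) = G (ncf_Theta s).
Proof.
apply: (G_unique _ (G_eqmod1 (ncf_Theta s))).
rewrite /eqmod1 !val_ncf_Theta [ncf_lim s]ncf_limE.
have := den_sub_neq0 (ncf_lim_half (shift s)) => h.
suff -> : ncf_lim (shift s) - - (1 / (1 / ((den s 0)%:~R - ncf_lim (shift s))))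
   = (den s 0)%:~R by exact: intr_int.
by field.
Qed.

(** * The inverse: itineraries under G *)

Lemma Theta_bounds t : -(1 / 2) < val t < 1 / 2.
Proof. by have [] := set_mem (valP t); rewrite /= in_itv. Qed.

Lemma Theta_neq_rat t (q : rat) : val t != ratr q.
Proof. by apply/eqP => h; have [_ []] := set_mem (valP t); exists q. Qed.

Lemma Theta_neq0 t : val t != 0.
Proof. by have := Theta_neq_rat t 0; rewrite rmorph0. Qed.

Lemma Theta_inv_neq_int t (k : int) : (val t)^-1 != k%:~R.
Proof.
have := Theta_neq_rat t (k%:~R^-1).
by rewrite fmorphV /= ratr_int; apply: contraNneq => <-; rewrite invrK.
Qed.

Definition inv_floor t : nat := Num.truncn `|val t|^-1.

(** The lower bound is strict because the inverse is not an integer; this is what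
    makes [digit] locally constant. *)
Lemma inv_floor_itv t :
  (inv_floor t)%:R < `|val t|^-1 < (inv_floor t).+1%:R.
Proof.
have /truncn_itv/andP[h1 h2] : 0 <= `|val t|^-1 by rewrite invr_ge0.
rewrite /inv_floor h2 andbT lt_neqAle h1 andbT.
rewrite -normfV; case: ger0P => _.
  by rewrite eq_sym; exact: (Theta_inv_neq_int t (Num.truncn _)%:Z).
rewrite eq_sym eqr_oppLR.
have := Theta_inv_neq_int t (- (Num.truncn (- (val t)^-1))%:Z).
by rewrite mulrNz.
Qed.

Lemma digit_subproof t : in_alphabet (sgz (val t), inv_floor t).
Proof.
rewrite /in_alphabet /=; apply/andP; split.
  by case: sgzP (Theta_neq0 t).
have /andP[t1 t2] := Theta_bounds t.
rewrite -ltnS -(ltr_nat R).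
have /andP[_] := inv_floor_itv t; apply: le_lt_trans.
rewrite -[2%:R]invrK lef_pV2 ?posrE ?normr_gt0 ?Theta_neq0//.
by rewrite ler_norml; lra.
Qed.

Definition digit t : Sigma :=
  exist (fun p => in_alphabet p) _ (digit_subproof t).

Definition itinerary t : SigmaN := fun n => digit (iter n (@G R) t).

Lemma itinerary_G t : itinerary (G t) = shift (itinerary t).
Proof. by apply: funext => n; rewrite /itinerary /shift -iterSr. Qed.

Lemma eq_digit t c :
  0 < epsR c * val t ->
  (abar c)%:R <= epsR c / val t < (abar c).+1%:R -> digit t = c.
Proof.
move=> ct ci; apply: val_inj => /=.
rewrite [RHS]surjective_pairing -/(eps c) -/(abar c).
have tn : `|val t| = epsR c * val t.
  rewrite -(gtr0_norm ct) normrM.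
  by case: (epsR_pm1 c) => ->; rewrite ?normrN normr1 mul1r.
congr pair; last first.
  rewrite /inv_floor tn; apply: truncn_def.
  by move: ci; rewrite invfM; case: (epsR_pm1 c) => ->; rewrite ?invrN invr1.
move: ct; rewrite /epsR; case: (eps_pm1 c) => ->.
  by rewrite mulN1r oppr_gt0 => /ltr0_sgz.
by rewrite mul1r => /gtr0_sgz.
Qed.

Lemma digit_spec t : 0 < epsR (digit t) * val t /\
  (abar (digit t))%:R < epsR (digit t) / val t < (abar (digit t)).+1%:R.
Proof.
have tn : epsR (digit t) * val t = `|val t|.
  rewrite /epsR /eps /=; case: (ltgtP (val t) 0) (Theta_neq0 t) => // t0 _.
    by rewrite (ltr0_sgz t0) ltr0_norm// mulN1r.
  by rewrite (gtr0_sgz t0) gtr0_norm// mul1r.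
split; first by rewrite tn normr_gt0 Theta_neq0.
have := inv_floor_itv t; rewrite -tn invfM.
by case: (epsR_pm1 (digit t)) => ->; rewrite ?invrN invr1.
Qed.

(** The inverse of the limit is [den s 0 - T'], with [T'] the next tail, so that
    up to sign it is [abar + 1 - |T'|] or [abar + |T'|], according to whether the
    first two signs agree; its integer part is [abar] in both cases. *)
Lemma digit_ncf_Theta s : digit (ncf_Theta s) = s 0.
Proof.
have [_ e0] := ncf_lim_half s; have [] := ncf_lim_half (shift s).
have s0 := ncf_lim_neq0 s; have s1 := ncf_lim_neq0 (shift s).
rewrite ler_norml => /andP[h1 h2]; rewrite -[shift s 0%N]/(s 1%N) => e1.
apply: eq_digit; rewrite val_ncf_Theta.
  by rewrite lt_neqAle e0 eq_sym mulf_neq0// epsR_neq0.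
rewrite ncf_limE div1r invrK -natr1 den0E.
have : 0 < epsR (s 1) * ncf_lim (shift s).
  by rewrite lt_neqAle e1 eq_sym mulf_neq0// epsR_neq0.
by case: (epsR_pm1 (s 0)) => ->; case: (epsR_pm1 (s 1)) => -> ?;
  apply/andP; split; lra.
Qed.

Lemma itinerary_ncf_Theta s : itinerary (ncf_Theta s) = s.
Proof.
apply: funext => n; elim: n s => [|n IHn] s; first exact: digit_ncf_Theta.
rewrite -[LHS]/(shift (itinerary (ncf_Theta s)) n) -itinerary_G.
by rewrite -ncf_Theta_shift IHn.
Qed.

Lemma eqmod1_close v w : eqmod1 v w -> `|v - w| < 1 -> v = w.
Proof.
move=> /intrP[k kE]; rewrite kE -intr_norm (ltr_int R _ 1) => k1.
by apply/eqP; rewrite -subr_eq0 kE intr_eq0; case: k k1 {kE} => -[].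
Qed.

Lemma eqmod1_half v w : -(1 / 2) < v < 1 / 2 -> -(1 / 2) < w < 1 / 2 ->
  eqmod1 v w -> v = w.
Proof. by move=> ? ? vw; apply: eqmod1_close vw _; rewrite ltr_norml; lra. Qed.

(** With [e] the sign of [t] and [e'] that of [G t], both [G t] and
    [den - 1 / t] lie strictly between 0 and [e'], by the choice of the correction
    term in [den]; being congruent to [- 1 / t], they are equal. *)
Lemma den_itinerary t : (den (itinerary t) 0)%:~R = (val t)^-1 + val (G t).
Proof.
have [_] := digit_spec t; have [] := digit_spec (G t).
have /andP[] := Theta_bounds (G t).
have := G_eqmod1 t; rewrite div1r.
have := den0E (itinerary t).
rewrite -[itinerary t 0%N]/(digit t) -[itinerary t 1%N]/(digit (G t)).
move=> dE Gm w1 w2 w0 _ /andP[+ +]; rewrite -natr1 => a1 a2.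
apply: eqmod1_close.
  by rewrite /eqmod1 [_^-1 + _]addrC -[_^-1]opprK rpredB ?intr_int.
rewrite dE ltr_norml; move: w0 a1 a2.
by case: (epsR_pm1 (digit t)) => ->; case: (epsR_pm1 (digit (G t))) => -> *;
  apply/andP; split; lra.
Qed.

Lemma itinerary_half t : half_interval (digit t) (val t).
Proof.
have [t0 _] := digit_spec t; have /andP[t1 t2] := Theta_bounds t.
by split; [rewrite ler_norml; lra | exact: ltW].
Qed.

Lemma itinerary_close n t :
  `|val t - convergent n (itinerary t)| <= (1 / 4) ^+ n.
Proof.
elim: n t => [|n IHn] t; first exact/convergent_close0/itinerary_half.
have -> : val t = 1 / ((den (itinerary t) 0)%:~R - val (G t)).
  by rewrite den_itinerary addrK div1r invrK.
apply: convergent_closeS; first exact: itinerary_half (G t).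
by rewrite -itinerary_G; exact: IHn.
Qed.

Lemma ncf_Theta_itinerary t : ncf_Theta (itinerary t) = t.
Proof.
apply: val_inj; rewrite val_ncf_Theta; apply: cvg_lim => //.
apply/cvgrPdist_lt => e /expr_quarter_lt[N Ne]; exists N => //= n Nn.
apply: le_lt_trans (itinerary_close n t) _.
by apply: le_lt_trans Ne; apply: ler_wiXn2l => //; lra.
Qed.

(** * Continuity in both directions *)

(** [SigmaN] being a defined constant, typeclass search does not see through it to
    the product topology. *)
#[local] Instance nbhs_SigmaN_filter s : ProperFilter (nbhs s) :=
  @nbhs_pfilter {ptws nat -> Sigma} s.

Lemma cylinder_near s n : \forall s' \near s, forall k, (k < n)%N -> s' k = s k.
Proof.
elim: n => [|n IHn]; first by near=> s'.
have sn : \forall s' \near s, s' n = s n.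
  exact: (@proj_continuous nat (fun=> Sigma) n s [set s n] (discrete_set1 _)).
near=> s' => k; rewrite ltnS leq_eqVlt => /orP[/eqP ->|]; first by near: s'.
by apply: (near IHn s').
Unshelve. all: by end_near. Qed.

(** One letter more than the length is read, since [b s n] involves the sign of
    the letter [n.+1]. *)
Lemma convergent_eq n s s' : (forall k, (k <= n)%N -> s' k = s k) ->
  convergent n s' = convergent n s.
Proof.
move=> ss'; congr (ncf R _); apply/eq_in_map => k.
by rewrite mem_iota /= add0n /den /b => kn; rewrite !ss'// ltnW.
Qed.

Lemma ncf_lim_continuous : continuous ncf_lim.
Proof.
move=> s; apply/cvgrPdist_lt => e e0.
have [N Ne] : exists n, (1 / 4) ^+ n < e / 2 by apply: expr_quarter_lt; lra.
near=> s'.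
have cE : convergent N s' = convergent N s.
  by apply: convergent_eq => k kN; apply: (near (cylinder_near s N.+1) s').
have := ncf_lim_close N s; have := ncf_lim_close N s'.
rewrite cE => h1 h2; rewrite -[ncf_lim s](subrK (convergent N s)) -addrA.
apply: le_lt_trans (ler_normD _ _) _.
by rewrite [`|convergent N s - _|]distrC; lra.
Unshelve. all: by end_near. Qed.

Lemma ncf_Theta_continuous : continuous ncf_Theta.
Proof.
apply: (continuous_comp_initial (w := set_val) (f := ncf_Theta)).
exact: ncf_lim_continuous.
Qed.

Lemma val_continuous : continuous (val : Theta R -> R).
Proof. exact: initial_continuous. Qed.

Lemma inv_continuous : continuous (fun t => (val t)^-1).
Proof. by move=> t; exact: (cvgV (Theta_neq0 t) (@val_continuous t)). Qed.

(** Let [k] be the integer with [G t = k - 1 / t].  For [u] near [t], the number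
    [k - 1 / u] stays in the open interval (-1/2, 1/2), so it is [G u]. *)
Lemma G_continuous : continuous (@G R).
Proof.
apply: (continuous_comp_initial (w := set_val) (f := @G R)) => t.
pose k := val (G t) + (val t)^-1.
have kI : k \is a Num.int by have := G_eqmod1 t; rewrite /eqmod1 div1r opprK.
have cvk : (k - (val u)^-1) @[u --> t] --> val (G t).
  rewrite -[val (G t)](addrK (val t)^-1).
  exact: (cvgB (cvg_cst k) (@inv_continuous t)).
suff eqG : \forall u \near t, k - (val u)^-1 = val (G u).
  exact: cvg_trans (near_eq_cvg eqG) cvk.
have /andP[t1 t2] := Theta_bounds (G t).
near=> u.
have u1 : -(1 / 2) < k - (val u)^-1 by near: u; exact: cvgr_gt cvk _ t1.
have u2 : k - (val u)^-1 < 1 / 2 by near: u; exact: cvgr_lt cvk _ t2.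
apply: (eqmod1_half _ (Theta_bounds (G u))); first by rewrite u1 u2.
have := G_eqmod1 u; rewrite /eqmod1 div1r => Gu.
rewrite -addrA -opprD rpredB// [_ + set_val _]addrC.
by rewrite opprK in Gu.
Unshelve. all: by end_near. Qed.

(** The conditions characterizing the letter [digit t] are strict inequalities. *)
Lemma digit_locally_constant t : \forall u \near t, digit u = digit t.
Proof.
have [e0 /andP[a1 a2]] := digit_spec t.
have cv : epsR (digit t) * val u @[u --> t] --> epsR (digit t) * val t.
  exact: (cvgM (cvg_cst (epsR (digit t))) (@val_continuous t)).
have cv' : epsR (digit t) / val u @[u --> t] --> epsR (digit t) / val t.
  exact: (cvgM (cvg_cst (epsR (digit t))) (@inv_continuous t)).
near=> u; apply: eq_digit.
  by near: u; exact: cvgr_gt cv _ e0.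
apply/andP; split; last by near: u; exact: cvgr_lt cv' _ a2.
by apply: ltW; near: u; exact: cvgr_gt cv' _ a1.
Unshelve. all: by end_near. Qed.

Lemma digit_continuous : continuous digit.
Proof.
move=> t.
have digitF := fmap_filter digit (@nbhs_filter (Theta R) t).
exact: (@discrete_cvg Sigma _ (digit t) digitF).2 (digit_locally_constant t).
Qed.

Lemma itinerary_continuous : continuous itinerary.
Proof.
move=> t; have itinF := fmap_filter itinerary (@nbhs_filter (Theta R) t).
apply: (@pointwise_cvgP nat Sigma _ (itinerary t) itinF).2 => n.
have ctsG : continuous (iter n (@G R)).
  elim: n => [|n IHn] u; first exact: cvg_id.
  by apply: continuous_comp; [exact: IHn|exact: G_continuous].
exact: (continuous_comp (ctsG t) (@digit_continuous _)).
Qed.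

End NearestIntegerCoding.

Theorem theoremA (R : realType) :
  exists X : SigmaN -> Theta R,
    [/\ forall s : SigmaN,
          is_ncf (fun n => eps (s n) * b s n) (val (X s)),
        homeomorphism X
      & X \o shift = @G R \o X].
Proof.
exists ncf_Theta; split.
- by move=> s; split=> [n|]; [exact: den_ncf_defined|exact: convergent_cvg].
- split; first exact: ncf_Theta_continuous.
  exists itinerary; split.
  + exact: itinerary_ncf_Theta.
  + exact: ncf_Theta_itinerary.
  + exact: itinerary_continuous.
- by apply: funext => s; exact: ncf_Theta_shift.
Qed.
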